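(* Let $G$ be an $(X,Y)$-bigraph such that for every $A\subseteq X$ with $|A|\ge 3$ both of the following hold: (i) $|\widehat{N}(A)|\ge |A|$, and (ii) the induced subgraph $G[A\cup \widehat{N}(A)]$ is $2$-connected. Then $G$ is $k$-cyclic for each $k\in\{3,4,5,6\}$.
   Context: All graphs are finite and simple. An $(X,Y)$-bigraph is a bipartite graph $G$ with a specified ordered bipartition $(X,Y)$ of its vertex set. $N(v)$ denotes the set of neighbors of $v$ in $G$. For $A\subseteq X$, the super-neighborhood of $A$ is $\widehat{N}(A)=\{y\in Y: |N(y)\cap A|\ge 2\}$. For an integer $k\ge 3$, an $(X,Y)$-bigraph $G$ is $k$-cyclic if for every $X'\subseteq X$ with $|X'|=k$, $G$ has a cycle $C$ with $V(C)\cap X=X'$. *)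

(* Defs.v *)
From mathcomp Require Import all_boot.

Set Implicit Arguments.
Unset Strict Implicit.
Unset Printing Implicit Defensive.

(* A finite graph is an edge relation [e] on a finType [T].  The subgraph
   induced by [S : {set T}] is represented by the pair ([e], [S]). *)

Section Graphs.

Variable T : finType.
Implicit Types (e : rel T) (S D A X Y : {set T}) (c : seq T).

Definition simple_graph e : Prop := symmetric e /\ irreflexive e.

Definition bigraph e X Y : Prop :=
  [/\ simple_graph e,
      X :|: Y = [set: T],
      [disjoint X & Y] &
      forall u v, e u v -> (u \in X /\ v \in Y) \/ (u \in Y /\ v \in X)].

Definition nbhd e v : {set T} := [set u | e v u].

Definition super_nbhd e Y A : {set T} :=
  [set y in Y | 2 <= #|nbhd e y :&: A|].

Definition induced e S : rel T :=
  [rel u v | [&& u \in S, v \in S & e u v]].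

Definition connected_graph e S : Prop :=
  S != set0 /\ {in S &, forall u v, connect (induced e S) u v}.

Definition k_connected k e S : Prop :=
  k < #|S| /\
  forall D, D \subset S -> #|D| < k -> connected_graph e (S :\: D).

(* The bound on the size excludes the degenerate sequences for which
   [ucycle] also holds: the empty one, and a single edge run back and forth. *)
Definition graph_cycle e c : Prop := 3 <= size c /\ ucycle e c.

(* Used for [3 <= k] only. *)
Definition k_cyclic k e X : Prop :=
  forall X', X' \subset X -> #|X'| = k ->
  exists2 c, graph_cycle e c & [set x in c] :&: X = X'.

End Graphs.

(* Main.v *)
(** Vertices of Y are hyperedges on X, and a cycle through [A] is a Berge cycle
    on [A]: a cyclic order of [A] with distinct hyperedges containing the
    consecutive pairs.  By induction there is a Berge cycle on [A] minus a
    vertex [v]; by (i) some hyperedge outside it contains two vertices of [A],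
    and the cycle can be rotated to start at one of them other than [v].  If
    [A] had no Berge cycle, a finite case analysis on which of the at most six
    vertices lie in the hyperedges found so far would reach a contradiction
    from three counting rules: two vertices share a hyperedge, two intersecting
    pairs are covered by at least two hyperedges (both from (ii) for triples),
    and at least [#|A|] hyperedges meet [A] twice (this is (i)).  The case
    analysis is a backtracking search, proved sound and run by computation. *)

Require Import Defs.
From mathcomp Require Import all_boot.
From Stdlib Require Import Classical_Prop.

Set Implicit Arguments.
Unset Strict Implicit.
Unset Printing Implicit Defensive.

(** * The search on numbered vertices and hyperedges *)

(* [vm_compute] evaluates both arguments of [||] and [&&], so the search
   branches with [if]. *)
Fixpoint lazy_has (A : Type) (a : A -> bool) (s : seq A) : bool :=
  if s is x :: s' then if a x then true else lazy_has a s' else false.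

Fixpoint pairs (A : Type) (s : seq A) : seq (A * A) :=
  if s is x :: s' then [seq (x, y) | y <- s'] ++ pairs s' else [::].

Fixpoint sublists (A : Type) (s : seq A) : seq (seq A) :=
  if s is x :: s' then [seq x :: t | t <- sublists s'] ++ sublists s'
  else [:: [::]].

Definition argmin (A : Type) (f : A -> nat) (x : A) (s : seq A) : A :=
  foldl (fun a b => if f b < f a then b else a) x s.

Definition without (a : nat) (s : seq nat) := [seq b <- s | b != a].

(* Vertices and hyperedges are numbered.  Entry [v] of the [j]-th list tells
   whether hyperedge [j] contains vertex [v], [None] meaning still open. *)
Notation state := (seq (seq (option bool))).
(* The rule [(q, n)] asks for [n] hyperedges, each containing a pair of [q]. *)
Notation rule := (seq (nat * nat) * nat)%type.

Definition status (es : state) (j v : nat) : option bool :=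
  nth None (nth [::] es j) v.
Definition inside es j v := if status es j v is Some b then b else false.
Definition outside es j v := if status es j v is Some b then ~~ b else false.
Definition decide (es : state) (c : nat * nat) (b : bool) : state :=
  set_nth [::] es c.1 (set_nth None (nth [::] es c.1) c.2 (Some b)).

(** Looks for a Berge path from [u] to [t] with [n] inner vertices from [vs] and hyperedges from
    [js], none repeated, using only memberships settled as true. *)
Fixpoint route es n u vs t js : bool :=
  if n is n'.+1 then
    lazy_has (fun j =>
      if inside es j u then
        lazy_has (fun v =>
          if inside es j v then route es n' v (without v vs) t (without j js)
          else false) vs
      else false) js
  else lazy_has (fun j => if inside es j u then inside es j t else false) js.

Section Refute.
Variable k : nat.

Definition new_edge (p : nat * nat) : seq (option bool) :=
  mkseq (fun v => if v \in [:: p.1; p.2] then Some true else None) k.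

(* The search breaks ties in this order, which favours the vertex [k.-1] added
   to the inductive cycle; the opposite order takes far too long. *)
Definition cell_seq (es : state) : seq (nat * nat) :=
  [seq (j, v) | j <- iota 0 (size es), v <- rev (iota 0 k)].
Definition undecided es : seq (nat * nat) :=
  [seq c <- cell_seq es | ~~ isSome (status es c.1 c.2)].

(** This is a Hamiltonian Berge path from [a] to [b]: any further hyperedge through both ends would
    close it into a Berge cycle. *)
Definition spanning es a b js : bool :=
  route es k.-2 a (without a (without b (iota 0 k))) b js.

(** With vertex [c.2] in it, hyperedge [c.1] would join the ends of a spanning path made of other
    hyperedges. *)
Definition closes es (c : nat * nat) : bool :=
  let js := without c.1 (iota 0 (size es)) in
  lazy_has (fun u => if inside es c.1 u then
                       if u != c.2 then spanning es u c.2 js else false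
                     else false) (iota 0 k).

(** One pass suffices: [closes] reads only [inside], which a negative decision on an open entry
    leaves unchanged. *)
Definition exclude es : state :=
  foldl (fun es c => if closes es c then decide es c false else es)
        es (undecided es).

Definition free (es : state) : seq (nat * nat) :=
  [seq p <- pairs (iota 0 k) | ~~ spanning es p.1 p.2 (iota 0 (size es))].

(** The [undup] test keeps two pairs exactly when they share one vertex. *)
Definition rules : seq rule :=
  [seq ([:: p], 1) | p <- pairs (iota 0 k)] ++
  [seq ([:: z.1; z.2], 2) | z <- pairs (pairs (iota 0 k)) &
     size (undup [:: z.1.1; z.1.2; z.2.1; z.2.2]) == 3] ++
  [seq (pairs s, size s) | s <- sublists (iota 0 k) & 3 <= size s].

Definition may_contain es (q : seq (nat * nat)) j : bool :=
  lazy_has (fun p => if outside es j p.1 then false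
                     else ~~ outside es j p.2) q.
(** Even if every open membership turned out true, the known hyperedges would be too few for the
    rule, so a new one must exist. *)
Definition short es (r : rule) : bool :=
  count (may_contain es r.1) (iota 0 (size es)) < r.2.

Definition available (fr : seq (nat * nat)) (r : rule) : seq (nat * nat) :=
  [seq p <- r.1 | p \in fr].

Definition spread es (c : nat * nat) : nat :=
  count (fun j => ~~ outside es j c.2) (iota 0 (size es)).

(* [fr] lists the pairs that one more hyperedge can contain without closing a
   Berge cycle.  A rule is hard when none of its pairs is in [fr]: the known
   hyperedges alone must satisfy it. *)
Fixpoint refute (rs : seq rule) n fr es : bool :=
  if n is n'.+1 then
    let restart es := let es := exclude es in refute rs n' (free es) es in
    let hard := [seq r <- rs | nilp (available fr r)] in
    let cells := undecided es in
    let forced :=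
      [seq c <- cells | lazy_has (short (decide es c false)) hard] in
    if lazy_has (short es) hard then true
    else if forced is c :: cs then
      restart (foldl (fun es c => decide es c true) es forced)
    else if [seq available fr r | r <- rs & short es r] is q :: qs then
      all (fun p => restart (rcons es (new_edge p))) (argmin size q qs)
    else if cells is c :: cs then
      let c := argmin (spread es) c cs in
      if restart (decide es c true) then refute rs n' fr (decide es c false)
      else false
    else false
  else false.

(* 100 is ample fuel for [k <= 6]. *)
Definition refuted es : bool :=
  let es := exclude es in refute rules 100 (free es) es.

(** Vertices below [k.-1] carry the inductive cycle, whose last hyperedge returns to [0]; vertex
    [k.-1] is the one to be added. *)
Definition cycle_state : state :=
  [seq new_edge (i, if i.+2 == k then 0 else i.+1) | i <- iota 0 k.-1].
End Refute.

(** * Lists, pairs and sublists *)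

Lemma lazy_hasE (A : Type) (a : A -> bool) s : lazy_has a s = has a s.
Proof. by elim: s => //= x s ->; case: (a x). Qed.

Lemma mem_pairs (A : eqType) (a b : A) s :
  a \in s -> b \in s -> a != b -> ((a, b) \in pairs s) || ((b, a) \in pairs s).
Proof.
elim: s => //= x s IHs; rewrite !inE !mem_cat.
case/predU1P=> [->|sa]; case/predU1P=> [->|sb]; rewrite ?eqxx // => ab.
- by rewrite (map_f (pair x) sb).
- by rewrite (map_f (pair x) sa) orbT.
- by case/orP: (IHs sa sb ab) => ->; rewrite ?orbT.
Qed.

Lemma mem_pairsW (A : eqType) (p : A * A) s :
  p \in pairs s -> p.1 \in s /\ p.2 \in s.
Proof.
elim: s => //= x s IHs; rewrite mem_cat => /orP[/mapP[y sy ->]|/IHs[]] /=.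
  by rewrite mem_head inE sy orbT.
by rewrite !inE => -> ->; rewrite !orbT.
Qed.

Lemma pairs_subseq (A : eqType) (s t : seq A) :
  subseq s t -> subseq (pairs s) (pairs t).
Proof.
elim: t s => [|y t IHt] [|x s] //; first by move=> _; apply: sub0seq.
rewrite /=; case: (x =P y) => [->|_] st; last first.
  exact: subseq_trans (IHt _ st) (suffix_subseq _ _).
by rewrite cat_subseq ?IHt // map_subseq.
Qed.

Lemma pairs_iota m n a b :
  (a, b) \in pairs (iota m n) -> [/\ m <= a, a < b & b < m + n].
Proof.
elim: n m => //= n IHn m; rewrite mem_cat => /orP[/mapP[c]|/IHn[ma ab bn]].
  by rewrite mem_iota => /andP[mc cn] [-> ->]; rewrite leqnn mc addnS -addSn.
by rewrite (ltnW ma) ab addnS -addSn.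
Qed.

Lemma sublists_subseq (A : eqType) (s t : seq A) :
  t \in sublists s -> subseq t s.
Proof.
elim: s t => [|x s IHs] t /=; first by rewrite inE => /eqP->.
rewrite mem_cat => /orP[/mapP[u /IHs us ->]|/IHs ts].
  by rewrite /= eqxx.
exact: subseq_trans ts (subseq_cons _ _).
Qed.

Lemma mem_argmin (A : eqType) (f : A -> nat) x s : argmin f x s \in x :: s.
Proof.
rewrite /argmin; elim: s x => [|y s IHs] x /=; first exact: mem_head.
case: ifP => _; first by rewrite inE IHs orbT.
by have := IHs x; rewrite !inE => /orP[->//|->]; rewrite !orbT.
Qed.

Lemma mem_without a s b : (b \in without a s) = (b != a) && (b \in s).
Proof. by rewrite mem_filter. Qed.

(** * Berge paths *)

Section Trail.
Variables (V J : Type) (inc : V -> J -> bool).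

(** A Berge path with inner vertices [vs] and one hyperedge more than these; [u = t] makes it
    closed. Incidence is a parameter, to serve both search states and the graph. *)
Fixpoint trail (u : V) (vs : seq V) (t : V) (ys : seq J) : bool :=
  match vs, ys with
  | [::], [:: y] => inc u y && inc t y
  | v :: vs', y :: ys' => [&& inc u y, inc v y & trail v vs' t ys']
  | _, _ => false
  end.

Lemma size_trail u vs t ys : trail u vs t ys -> size ys = (size vs).+1.
Proof.
elim: vs u ys => [|v vs IHvs] u [|y ys] //=; first by case: ys.
by case/and3P=> _ _ /IHvs->.
Qed.

Lemma trail_cat u vs w vs' t ys ys' :
    trail u vs w ys -> trail w vs' t ys' ->
  trail u (vs ++ w :: vs') t (ys ++ ys').
Proof.
elim: vs u ys => [|v vs IHvs] u [|y ys] //=.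
  by case: ys => //= /andP[-> ->].
by case/and3P=> -> -> /IHvs.
Qed.

Lemma trail_split u vs w vs' t ys :
  trail u (vs ++ w :: vs') t ys ->
  exists ys1 ys2, [/\ ys = ys1 ++ ys2, trail u vs w ys1 & trail w vs' t ys2].
Proof.
elim: vs u ys => [|v vs IHvs] u [|y ys] //= /and3P[uy vy].
  by exists [:: y], ys; rewrite /= uy vy.
by case/IHvs=> ys1 [ys2 [-> tr1 tr2]]; exists (y :: ys1), ys2; rewrite /= uy vy.
Qed.

Lemma trail_inc u vs t ys (v0 : V) (y0 : J) j :
    trail u vs t ys -> j < size ys ->
  inc (nth v0 (u :: vs) j) (nth y0 ys j)
    && inc (nth v0 (rcons vs t) j) (nth y0 ys j).
Proof.
elim: vs u ys j => [|v vs IHvs] u [|y ys] //= j.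
  by case: ys j => // -[].
by case/and3P=> uy vy /IHvs tr; case: j => [_|j]; [rewrite /= uy vy | apply: tr].
Qed.
End Trail.

Lemma trail_map (V J V' J' : Type) (inc : V -> J -> bool)
    (inc' : V' -> J' -> bool) f g u vs t ys :
    (forall v y, inc v y -> inc' (f v) (g y)) -> trail inc u vs t ys ->
  trail inc' (f u) (map f vs) (f t) (map g ys).
Proof.
move=> ff; elim: vs u ys => [|v vs IHvs] u [|y ys] //=.
  by case: ys => // /andP[/ff-> /ff->].
by case/and3P=> /ff-> /ff-> /IHvs.
Qed.

(** Each step of [route] discards the vertex and the hyperedge it uses; with [size vs = n] it
    therefore exhausts [vs] without repetition. *)
Lemma route_trail es n u vs t js :
    route es n u vs t js -> uniq vs -> uniq js -> size vs = n ->
  exists vs' js', [/\ perm_eq vs' vs, uniq js', {subset js' <= js}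
    & trail (fun v j => inside es j v) u vs' t js'].
Proof.
elim: n u vs js => [|n IHn] u vs js /=; rewrite lazy_hasE => /hasP[j js_j].
  case: ifP => // ju jt _ _ /size0nil->; exists [::], [:: j]; split=> //=.
    by move=> i; rewrite inE => /eqP->.
  by rewrite ju jt.
case: ifP => // ju; rewrite lazy_hasE => /hasP[v vs_v]; case: ifP => // jv.
move=> r Uvs Ujs szvs.
have Ev: without v vs = rem v vs by rewrite rem_filter.
have [||| vs' [js' [Evs Ujs' sjs tr]]] := IHn _ _ _ r.
- exact: filter_uniq.
- exact: filter_uniq.
- by rewrite Ev size_rem // szvs.
exists (v :: vs'), (j :: js'); split.
- by rewrite perm_sym (perm_trans (perm_to_rem vs_v)) // perm_cons perm_sym -Ev.
- by rewrite /= Ujs' andbT; apply: contraTN isT => /sjs; rewrite mem_without eqxx.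
- by move=> i /predU1P[->//|/sjs]; rewrite mem_without => /andP[].
- by rewrite /= ju jv.
Qed.

(** * Berge cycles and cycles of the bigraph *)

Section Berge.
Variables (T : finType) (e : rel T) (Y : {set T}).

Definition berge_cycle (A : {set T}) (u : T) (vs ys : seq T) : Prop :=
  [/\ uniq (u :: vs), u :: vs =i A, uniq ys, {subset ys <= Y}
    & trail e u vs u ys].

(** The closed trail is cut at [p] and its two pieces are exchanged. *)
Lemma berge_cycle_rot A u vs ys p : berge_cycle A u vs ys -> p \in A ->
  exists vs' ys', berge_cycle A p vs' ys' /\ ys' =i ys.
Proof.
case=> Uvs vsA Uys ysY tr; rewrite -vsA => /predU1P[->|]; first by exists vs, ys.
move=> vs_p; case/splitPr: vs / vs_p Uvs vsA tr => s1 s2 Uvs vsA.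
move=> tr; have [ys1 [ys2 [Eys tr1 tr2]]] := trail_split tr.
have Evs : perm_eq (p :: s2 ++ u :: s1) (u :: s1 ++ p :: s2).
  by rewrite -!cat_cons perm_catC.
exists (s2 ++ u :: s1), (ys2 ++ ys1); split; last first.
  by move=> y; rewrite Eys !mem_cat orbC.
split.
- by rewrite (perm_uniq Evs).
- by move=> z; rewrite (perm_mem Evs) vsA.
- by rewrite uniq_catC -Eys.
- by move=> y; rewrite mem_cat orbC -mem_cat -Eys; apply: ysY.
- exact: trail_cat tr2 tr1.
Qed.

(** Alternates hyperedges and inner vertices, both being vertices of the bigraph; the surplus
    hyperedge of a trail comes last. *)
Fixpoint weave (vs ys : seq T) : seq T :=
  match vs, ys with
  | v :: vs', y :: ys' => y :: v :: weave vs' ys'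
  | _, _ => ys
  end.

Lemma weave_path (sym_e : symmetric e) u vs t ys :
  trail e u vs t ys -> path e u (rcons (weave vs ys) t).
Proof.
elim: vs u ys => [|v vs IHvs] u [|y ys] //=.
  by case: ys => //= /andP[-> ty]; rewrite sym_e ty.
by case/and3P=> -> vy /IHvs->; rewrite sym_e vy.
Qed.

Lemma perm_weave vs ys :
  size vs <= size ys -> perm_eq (weave vs ys) (vs ++ ys).
Proof.
elim: vs ys => [|v vs IHvs] [|y ys] //= /IHvs Evs.
apply: (@perm_trans _ (y :: v :: vs ++ ys)); first by rewrite !perm_cons.
exact: permEl (perm_catCA [:: y] (v :: vs) ys).
Qed.
End Berge.

(** The woven cycle repeats no vertex because [X] and [Y] are disjoint, and it has at least [#|A|]
    vertices. *)
Lemma berge_graph_cycle (T : finType) (e : rel T) (X Y A : {set T}) u vs ys :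
    bigraph e X Y -> A \subset X -> 3 <= #|A| -> berge_cycle e Y A u vs ys ->
  exists2 c, graph_cycle e c & [set x in c] :&: X = A.
Proof.
case=> -[sym_e _] _ dXY _ sAX A3 [Uvs vsA Uys ysY tr].
have sz : size ys = (size vs).+1 := size_trail tr.
have Ec : perm_eq (u :: weave vs ys) ((u :: vs) ++ ys).
  by rewrite /= perm_cons perm_weave // sz.
have vsX v : v \in u :: vs -> v \in X by rewrite vsA; apply: subsetP.
have ysX y : y \in ys -> y \notin X.
  by move=> /ysY yY; apply: contraTN yY => yX; rewrite (disjointFr dXY).
exists (u :: weave vs ys).
  split; last rewrite /ucycle /= (weave_path sym_e tr) -/(uniq (_ :: _)).
    rewrite (perm_size Ec) size_cat; apply: leq_trans (leq_addr _ _).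
    by rewrite -(card_uniqP Uvs) (eq_card vsA).
  rewrite (perm_uniq Ec) cat_uniq Uvs Uys andbT; apply/hasPn=> y /ysX.
  by apply: contra => /vsX.
apply/setP=> z; rewrite !inE -in_cons (perm_mem Ec) mem_cat -vsA.
case: (boolP (z \in u :: vs)) => [/vsX-> //|_] /=.
by case: (boolP (z \in ys)) => // /ysX/negbTE->.
Qed.

(** * Soundness of the search *)

Section Soundness.
Variables (T : finType) (e : rel T) (Y A : {set T}) (k : nat) (x : nat -> T).

Definition spans (y : T) (p : nat * nat) : bool := e (x p.1) y && e (x p.2) y.

Definition demand (r : rule) : Prop :=
  r.2 <= #|[set y in Y | has (spans y) r.1]|.

Hypothesis x_inj : {in gtn k &, injective x}.
Hypothesis x_onto : map x (iota 0 k) =i A.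
Hypothesis no_berge_cycle : forall u vs ys, ~ berge_cycle e Y A u vs ys.
Hypothesis demands : forall r : rule, r \in rules k -> demand r.

(** The actual hyperedges [ys] follow the order of the state. Only settled entries constrain them,
    so the default [x 0] is never reached. *)
Definition models (es : state) (ys : seq T) : Prop :=
  [/\ size es = size ys, uniq ys, {subset ys <= Y} &
      forall j v b, status es j v = Some b -> e (x v) (nth (x 0) ys j) = b].

Lemma models_inside es ys j v :
  models es ys -> inside es j v -> e (x v) (nth (x 0) ys j).
Proof.
by case=> _ _ _ m; rewrite /inside; case E: status => [[]|] // _; apply: m E.
Qed.

Lemma models_outside es ys j v :
  models es ys -> e (x v) (nth (x 0) ys j) -> ~~ outside es j v.
Proof.
by case=> _ _ _ m; rewrite /outside; case E: status => [[]|] //; rewrite (m _ _ _ E).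
Qed.

Lemma models_decide es ys c :
    models es ys -> c.1 < size es ->
  models (decide es c (e (x c.2) (nth (x 0) ys c.1))) ys.
Proof.
case: c => j v /= [sz Uys ysY m] jes; split=> //.
  by rewrite size_set_nth -sz; apply/maxn_idPr.
move=> i w b; rewrite /status nth_set_nth /=; case: eqVneq => [->|_]; last exact: m.
by rewrite nth_set_nth /=; case: eqVneq => [-> [<-]|_]; [|apply: m].
Qed.

Lemma models_rcons es ys y p :
    models es ys -> y \in Y -> y \notin ys -> spans y p ->
  models (rcons es (new_edge k p)) (rcons ys y).
Proof.
case=> sz Uys ysY m yY ys'y /andP[yp1 yp2]; split.
- by rewrite !size_rcons sz.
- by rewrite rcons_uniq ys'y.
- by move=> z; rewrite mem_rcons => /predU1P[->//|/ysY].
move=> j v b; rewrite /status !nth_rcons sz.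
case: ltngtP => [_|_|_]; [exact: m | by rewrite nth_nil |].
have [vk|kv] := ltnP v k; last by rewrite nth_default // size_mkseq.
by rewrite nth_mkseq // !inE; case: ifP => // /orP[]/eqP-> [<-].
Qed.

Lemma berge_cycle_of_spanning es ys a b js y :
    models es ys -> spanning k es a b js -> uniq js ->
    {subset js <= gtn (size es)} -> a < k -> b < k -> a != b ->
    y \in Y -> y \notin map (nth (x 0) ys) js -> spans y (a, b) ->
  False.
Proof.
move=> m r Ujs js_es ak bk ab yY ys'y /andP[/= ya yb].
have Erest: perm_eq (a :: b :: without a (without b (iota 0 k))) (iota 0 k).
  have Uk := iota_uniq 0 k; apply: uniq_perm => //=.
    rewrite inE !mem_without (negbTE ab) !eqxx /= !filter_uniq //.
    by rewrite andbF.
  move=> v; rewrite !inE !mem_without mem_iota /= add0n.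
  by case: eqVneq => [->|_]; case: eqVneq => [->|_].
have szrest: size (without a (without b (iota 0 k))) = k.-2.
  by have:= perm_size Erest; rewrite /= size_iota => /(congr1 (fun n => n.-2)).
have [|vs' [js' [Evs Ujs' sjs tr]]] := route_trail r _ Ujs szrest.
  by rewrite !filter_uniq ?iota_uniq.
have [sz Uys ysY _] := m.
pose f := nth (x 0) ys.
have js'_ys j : j \in js' -> j < size ys by move/sjs/js_es; rewrite inE sz.
have tr' : trail e (x a) (map x vs') (x b) (map f js').
  by apply: trail_map tr => v j; apply: models_inside m.
have Ex : perm_eq (x a :: rcons (map x vs') (x b)) (map x (iota 0 k)).
  rewrite -map_rcons -map_cons; apply: perm_map; apply: perm_trans Erest.
  by rewrite perm_cons perm_rcons perm_cons.
(* The path runs from [x a] to [x b], and [y] leads back. *)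
apply: (@no_berge_cycle (x a) (rcons (map x vs') (x b)) (map f js' ++ [:: y])).
split.
- rewrite (perm_uniq Ex) map_inj_in_uniq ?iota_uniq // => u v.
  by rewrite !mem_iota; apply: x_inj.
- by move=> z; rewrite (perm_mem Ex) x_onto.
- rewrite cats1 rcons_uniq map_inj_in_uniq ?Ujs' ?andbT.
    by apply: contra ys'y => /mapP[j /sjs js_j ->]; apply: map_f.
  by move=> i j /js'_ys iy /js'_ys jy /eqP; rewrite nth_uniq // => /eqP.
- move=> z; rewrite mem_cat inE => /orP[/mapP[j /js'_ys jy ->]|/eqP->//].
  by rewrite ysY ?mem_nth.
- by rewrite -cats1; apply: trail_cat tr' _; rewrite /= ya yb.
Qed.

Lemma closesF es ys c :
    models es ys -> c.1 < size es -> c.2 < k -> closes k es c ->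
  e (x c.2) (nth (x 0) ys c.1) = false.
Proof.
case: c => j v /= m jes vk; rewrite /closes lazy_hasE => /hasP[u].
rewrite mem_iota /= add0n => uk; case: ifP => // uj; case: ifP => // uv r.
have [sz Uys ysY _] := m.
apply/negP=> yv.
(* Hyperedge [j] itself closes the cycle; [closes] left it out of the path. *)
apply: (berge_cycle_of_spanning m r _ _ uk vk uv (y := nth (x 0) ys j)).
- exact/filter_uniq/iota_uniq.
- by move=> i; rewrite mem_without mem_iota => /and3P[].
- by rewrite ysY ?mem_nth -?sz.
- apply/mapP=> -[i]; rewrite mem_without mem_iota /= add0n => /andP[ij ies] /eqP.
  by rewrite nth_uniq -?sz // eq_sym (negbTE ij).
- by rewrite /spans /= yv (models_inside m uj).
Qed.

Lemma undecidedP es c : c \in undecided k es -> c.1 < size es /\ c.2 < k.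
Proof.
rewrite mem_filter => /andP[_ /allpairsP[[j v] [/= js vs ->]]].
by move: js vs; rewrite mem_rev !mem_iota.
Qed.

Lemma size_decide es c b : c.1 < size es -> size (decide es c b) = size es.
Proof. by move=> ces; rewrite size_set_nth; apply/maxn_idPr. Qed.

Lemma models_exclude es ys : models es ys -> models (exclude k es) ys.
Proof.
rewrite /exclude => m.
have: {in undecided k es, forall c, c.1 < size es /\ c.2 < k}.
  by move=> c; apply: undecidedP.
move: (undecided k es) => cs; elim: cs es m => //= c cs IHcs es m cs_es.
have [ces ck] := cs_es c (mem_head _ _).
have cs_es' : {in cs, forall c, c.1 < size es /\ c.2 < k}.
  by move=> d cs_d; apply: cs_es; rewrite inE cs_d orbT.
case: ifP => [cl|_]; apply: IHcs => //; last by rewrite size_decide.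
by rewrite -(closesF m ces ck cl); apply: models_decide.
Qed.

(** This invariant mentions [ys] but not the state, so it survives any decision about an entry. *)
Definition covers_rest (fr : seq (nat * nat)) (ys : seq T) : Prop :=
  forall y p, y \in Y -> y \notin ys -> p \in pairs (iota 0 k) -> spans y p ->
  p \in fr.

Lemma free_covers es ys : models es ys -> covers_rest (free k es) ys.
Proof.
move=> m y [a b] yY ys'y ab yab; rewrite mem_filter ab andbT; apply/negP=> r.
have [_ lt_ab bk] := pairs_iota ab; have [sz Uys ysY _] := m.
apply: (berge_cycle_of_spanning m r _ _ _ bk _ yY _ yab).
- exact: iota_uniq.
- by move=> i; rewrite mem_iota.
- exact: ltn_trans bk.
- by rewrite ltn_eqF.
- apply: contra ys'y => /mapP[i]; rewrite mem_iota /= add0n sz => iys ->.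
  exact: mem_nth.
Qed.

Lemma rules_pairs r p : r \in rules k -> p \in r.1 -> p \in pairs (iota 0 k).
Proof.
rewrite !mem_cat => /or3P[] /mapP[z zP ->] /=.
- by rewrite inE => /eqP->.
- move: zP; rewrite mem_filter => /andP[_ /mem_pairsW[z1 z2]].
  by rewrite !inE => /orP[]/eqP->.
- move: zP; rewrite mem_filter => /andP[_ /sublists_subseq/pairs_subseq sub].
  exact: (mem_subseq sub).
Qed.

Lemma short_new es ys r : models es ys -> r \in rules k -> short es r ->
  exists y (p : nat * nat), [/\ y \in Y, y \notin ys, p \in r.1 & spans y p].
Proof.
move=> m rP; rewrite /short => sh.
have [sz Uys ysY _] := m.
(* [B] lists the known hyperedges that may serve the rule; being too few, they miss some hyperedge
   counted by [demand]. *)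
pose B := [seq nth (x 0) ys j | j <- iota 0 (size es) & may_contain es r.1 j].
have: ~~ ([set y in Y | has (spans y) r.1] \subset B).
  apply: contraL sh => /subset_leq_card sub; rewrite -leqNgt.
  apply: leq_trans (demands rP) (leq_trans sub _).
  by rewrite (leq_trans (card_size _)) // size_map size_filter.
case/subsetPn=> y; rewrite inE => /andP[yY /hasP[p rp yp]] B'y.
exists y, p; split=> //; apply: contra B'y => ys_y.
rewrite -(nth_index (x 0) ys_y); apply: map_f.
rewrite mem_filter mem_iota /= add0n sz index_mem ys_y andbT.
rewrite /may_contain lazy_hasE; apply/hasP; exists p => //.
case/andP: yp; rewrite -{1 2}(nth_index (x 0) ys_y) => yp1 yp2.
by rewrite (negbTE (models_outside m yp1)) (models_outside m yp2).
Qed.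

(** At each choice the actual incidences select one branch, and induction on the fuel shows that
    this branch cannot be refuted. *)
Lemma refute_sound n fr es ys :
  models es ys -> covers_rest fr ys -> refute k (rules k) n fr es -> False.
Proof.
elim: n fr es ys => //= n IHn fr es ys m cov.
pose restart es := refute k (rules k) n (free k (exclude k es)) (exclude k es).
have IHr es' ys' : models es' ys' -> restart es' -> False.
  by move=> /models_exclude m'; apply: IHn m' (free_covers m').
have new r : r \in rules k -> short es r -> exists y (p : nat * nat),
    [/\ y \in Y, y \notin ys, p \in available fr r & spans y p].
  move=> rP /(short_new m rP)[y [p [yY ys'y rp yp]]]; exists y, p; split=> //.
  by rewrite mem_filter rp andbT; apply: cov yp => //; apply: rules_pairs rp.
(* A short hard rule asks for a new hyperedge through a pair that [fr] forbids. *)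
rewrite lazy_hasE; case: hasP => [[r]|_].
  rewrite mem_filter => /andP[nil_r rP] /(new r rP)[y [p [_ _]]].
  by rewrite (nilP nil_r).
case E: [seq c <- _ | _] => [|c cs].
  case E2: [seq _ | r <- _ & _] => [|q qs]; last first.
    have: argmin size q qs \in q :: qs := mem_argmin size q qs.
    rewrite -E2 => /mapP[r]; rewrite mem_filter => /andP[sh rP] ->.
    have [y [p [yY ys'y rp yp]]] := new r rP sh.
    by move/allP/(_ p rp); apply: (IHr _ _ (models_rcons m yY ys'y yp)).
  case E3: (undecided k es) => [|c cs] //.
  set d := argmin _ c cs; have: d \in c :: cs := mem_argmin _ c cs.
  rewrite -E3 => /undecidedP[des dk].
  (* The actual membership decides which branch applies; where [fr] is kept, [cov] still holds
     because [ys] is unchanged. *)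
  have := models_decide m des; case: (e _ _) => m'; case: ifP => //.
    by move/(IHr _ _ m').
  by move=> _; apply: IHn m' cov.
(* Forced entries are true in the graph: a false one would make a hard rule short and so ask for a
   forbidden hyperedge. *)
rewrite -E => /(IHr _ ys); apply; have: {subset [seq c <- undecided k es |
   lazy_has (short (decide es c false)) [seq r <- rules k | nilp (available fr r)]] <=
   [pred c : nat * nat | (c.1 < size es) && e (x c.2) (nth (x 0) ys c.1)]}.
  move=> {c cs E}c; rewrite mem_filter => /andP[fc /undecidedP[ces ck]].
  rewrite inE ces /=; move: fc; rewrite lazy_hasE => /hasP[r].
  rewrite mem_filter => /andP[nil_r rP]; have := models_decide m ces.
  case: (e _ _) => // m' /(short_new m' rP)[y [p [yY ys'y rp yp]]].
  have: p \in available fr r.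
    by rewrite mem_filter rp andbT; apply: cov yp => //; apply: rules_pairs rp.
  by rewrite (nilP nil_r).
move: (filter _ _) => ds.
elim: ds es m {cov new E IHr IHn} => //= d ds IHds es m ds_es.
have /andP[des yd] := ds_es d (mem_head _ _).
apply: IHds; first by rewrite -yd; apply: models_decide.
move=> d' ds_d'; rewrite inE size_decide //.
by apply: ds_es; rewrite inE ds_d' orbT.
Qed.

Lemma refuted_sound es ys : models es ys -> ~~ refuted k es.
Proof.
rewrite /refuted; move: 100 => n /models_exclude m.
by apply/negP/(refute_sound m)/free_covers.
Qed.
End Soundness.

(** * Edges leaving a set, and the computed cases *)

Lemma connect_crossing (T : finType) (r : rel T) (B : {set T}) u v :
    connect r u v -> u \in B -> v \notin B ->
  exists a b, [/\ a \in B, b \notin B & r a b].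
Proof.
case/connectP=> p; elim: p u => [|w p IHp] u /=; first by move=> _ -> ->.
case/andP=> uw pw Ev Bu B'v; have [Bw|B'w] := boolP (w \in B).
  exact: IHp pw Ev Bw B'v.
by exists u, w.
Qed.

(** After rotation the additional hyperedge contains vertex [0]; [d] ranges over a second vertex in
    it, possibly the added [k.-1]. Triples start from the empty state instead. *)
Lemma refuted_cycle_states :
  all (fun k =>
         all (fun d => refuted k (rcons (cycle_state k) (new_edge k (0, d))))
             (iota 1 k.-1))
      [:: 4; 5; 6].
Proof. by vm_compute. Qed.

(** * The counting rules from the two hypotheses *)

Section Demands.
Variables (T : finType) (e : rel T) (X Y : {set T}).
Hypothesis bigraph_e : bigraph e X Y.
Hypothesis large_super_nbhd : forall A : {set T}, A \subset X -> 3 <= #|A| ->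
  #|A| <= #|super_nbhd e Y A|.
Hypothesis two_connected : forall A : {set T}, A \subset X -> 3 <= #|A| ->
  k_connected 2 e (A :|: super_nbhd e Y A).

Let sym_e : symmetric e. Proof. by case: bigraph_e => -[]. Qed.

Let XY v : v \in X -> v \in Y = false.
Proof. by case: bigraph_e => _ _ dXY _; apply: disjointFr. Qed.

Let adjXY u v : e u v -> u \in X -> v \in Y.
Proof.
by case: bigraph_e => _ _ _ /(_ u v)/[apply] -[[]//|[uY _] /XY]; rewrite uY.
Qed.

Let adjYX u v : e u v -> u \in Y -> v \in X.
Proof. by case: bigraph_e => _ _ _ /(_ u v)/[apply] -[[/XY->]|[]]. Qed.

Let triple_card (b c d : T) :
  b != c -> b != d -> c != d -> 3 <= #|[set b; c; d]|.
Proof.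
move=> bc bd cd; rewrite setUC cardsU1 !inE negb_or cards2 bc.
by rewrite eq_sym bd eq_sym cd.
Qed.

Let triple_sub (b c d : T) :
  b \in X -> c \in X -> d \in X -> [set b; c; d] \subset X.
Proof. by move=> bX cX dX; rewrite !subUset !sub1set bX cX. Qed.

Lemma common_neighbour b c d : b \in X -> c \in X -> d \in X ->
  b != c -> b != d -> c != d -> 0 < #|[set y in Y | e b y && e c y]|.
Proof.
move=> bX cX dX bc bd cd.
set S := [set b; c; d] :|: super_nbhd e Y [set b; c; d].
have [_ conn] := two_connected (triple_sub bX cX dX) (triple_card bc bd cd).
have [||_ {}conn] := conn [set d]; rewrite ?cards1 //.
  by rewrite sub1set !inE eqxx !orbT.
have bS : b \in S :\ d by rewrite !inE bd eqxx.
have cS : c \in S :\ d by rewrite !inE cd eqxx orbT.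
(* An edge leaving [b] and its hyperedges ends at another vertex of the triple; as [d] is deleted,
   this is [c]. *)
pose B := b |: [set y in Y | e b y].
have [||y [z [By B'z /and3P[_ zS yz]]]] :=
  connect_crossing (B := B) (conn _ _ bS cS).
- exact: setU11.
- by rewrite !inE eq_sym (negbTE bc) XY.
have zb : z != b by apply: contraNneq B'z => ->; apply: setU11.
case/setU1P: By yz => [-> bz|].
  by case/negP: B'z; rewrite !inE bz (adjXY bz) ?orbT.
rewrite inE => /andP[yY yb] yz.
have zX := adjYX yz yY.
move: zS; rewrite !inE (negbTE zb) (XY zX) /= orbF => /andP[zd].
rewrite (negbTE zd) orbF => /eqP zc; apply/card_gt0P; exists y.
by rewrite inE yY yb -zc sym_e.
Qed.

(** Otherwise deleting the at most one such hyperedge would isolate [b], because a hyperedge of the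
    super-neighborhood through [b] also contains [c] or [d]. *)
Lemma two_edges_at b c d : b \in X -> c \in X -> d \in X ->
    b != c -> b != d -> c != d ->
  2 <= #|[set y in Y | e b y && e c y || e b y && e d y]|.
Proof.
move=> bX cX dX bc bd cd; set W := [set y in Y | _].
have := two_connected (triple_sub bX cX dX) (triple_card bc bd cd).
set S := _ :|: _ => -[_ conn]; rewrite leqNgt; apply/negP=> W2.
have [||_ {}conn] := conn (W :&: S); first exact: subsetIr.
  exact: leq_ltn_trans (subset_leq_card (subsetIl _ _)) W2.
have bS : b \in S :\: (W :&: S) by rewrite !inE XY // eqxx.
have cS : c \in S :\: (W :&: S) by rewrite !inE XY // eqxx orbT.
have [||b' [y [/set1P-> yb /and3P[_ yS b_y]]]] :=
  connect_crossing (B := [set b]) (conn _ _ bS cS).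
- exact: set11.
- by rewrite inE eq_sym.
have yY := adjXY b_y bX; case/setDP: yS => yS; rewrite inE yS andbT => /negP[].
case/setUP: yS => [/(subsetP (triple_sub bX cX dX))/XY|]; first by rewrite yY.
rewrite !inE yY b_y /= leqNgt; apply: contraNT; rewrite negb_or => /andP[cy dy].
rewrite ltnS -(cards1 b) subset_leq_card //; apply/subsetP=> z; rewrite !inE sym_e.
by case/andP=> zy /orP[/pred2P[] Ez|/eqP Ez]; rewrite -?Ez ?zy ?eqxx in cy dy *.
Qed.

Section Labelling.
Variables (k : nat) (x : nat -> T).
Hypothesis k_ge3 : 3 <= k.
Hypothesis x_inj : {in gtn k &, injective x}.
Hypothesis xX : forall v, v < k -> x v \in X.

Lemma rules_demand r : r \in rules k -> demand e Y x r.
Proof.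
have xneq a b : a < k -> b < k -> a != b -> x a != x b.
  by move=> ak bk; apply: contraNneq => /x_inj->.
have pk p : p \in pairs (iota 0 k) -> [/\ p.1 < k, p.2 < k & p.1 != p.2].
  by case: p => a b /pairs_iota[_ ab bk]; rewrite (ltn_trans ab bk) ltn_eqF.
rewrite !mem_cat => /or3P[] /mapP[].
- move=> p /pk[p1 p2 p12] ->; rewrite /demand /=.
  (* A third vertex, available by [3 <= k], completes the pair to a triple. *)
  have [c ck] : exists2 c, c < k & (c != p.1) && (c != p.2).
    have /card_gt0P[c] : 0 < #|~: [set Ordinal p1; Ordinal p2]|.
      rewrite cardsCs setCK card_ord cards2 subn_gt0.
      by apply: leq_ltn_trans k_ge3; case: eqP.
    by rewrite !inE negb_or => /andP[c1 c2]; exists c => //; apply/andP.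
  case/andP=> c1 c2; under eq_finset => y do rewrite orbF.
  by apply: (@common_neighbour _ _ (x c)); rewrite ?xX ?xneq // eq_sym.
- case=> -[a b] [c d]; rewrite mem_filter /= => /andP[sz /mem_pairsW[]].
  move=> /pk[/= ak bk ab] /pk[/= ck dk cd] ->; rewrite /demand /=.
  have wedge u v w : u < k -> v < k -> w < k -> u != v -> u != w -> v != w ->
     2 <= #|[set y in Y | e (x u) y && e (x v) y || e (x u) y && e (x w) y]|.
    by move=> *; apply: two_edges_at; rewrite ?xX ?xneq.
  (* The four positions of the shared vertex; commuting conjunctions reduces each to [wedge]. *)
  have shape : [\/ a = c /\ b != d, a = d /\ b != c,
                   b = c /\ a != d | b = d /\ a != c].
    move: sz; rewrite /= !inE (negbTE ab) (negbTE cd) /=.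
    case: (eqVneq a c) => [<-|ac].
      by case: (eqVneq b d) => [_|bd _]; [rewrite orbT | apply: Or41].
    case: (eqVneq a d) => [<-|ad].
      by case: (eqVneq b c) => [_|bc _]; [| apply: Or42].
    case: (eqVneq b c) => [<-|bc]; first by move=> _; apply: Or43.
    by case: (eqVneq b d) => [<-|bd] // _; apply: Or44.
  rewrite /spans /=; under eq_finset => y do rewrite orbF.
  case: shape => -[E nE]; rewrite -?E in cd ck dk *.
  - exact: wedge.
  - under eq_finset => y do rewrite [e (x c) y && _]andbC.
    by apply: wedge => //; rewrite eq_sym.
  - under eq_finset => y do rewrite [e (x a) y && _]andbC.
    by apply: wedge => //; rewrite eq_sym.
  - under eq_finset => y do rewrite [e (x a) y && _]andbC [e (x c) y && _]andbC.
    by apply: wedge => //; rewrite eq_sym.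
- move=> s; rewrite mem_filter => /andP[s3 /sublists_subseq s_k] ->.
  rewrite /demand /=.
  have sk v : v \in s -> v < k by move/(mem_subseq s_k); rewrite mem_iota.
  have Us : uniq s := subseq_uniq s_k (iota_uniq 0 k).
  have Ux : uniq (map x s).
    by rewrite map_inj_in_uniq // => u v /sk uk /sk vk; apply: x_inj.
  have cardA : #|[set z in map x s]| = size s.
    by rewrite cardsE (card_uniqP Ux) size_map.
  have sAX : [set z in map x s] \subset X.
    by apply/subsetP=> z; rewrite inE => /mapP[v /sk/xX vX ->].
  (* This is (i) for the labelled subset: two neighbours of [y] in it form a pair of the rule. *)
  have := large_super_nbhd sAX; rewrite cardA => /(_ s3)/leq_trans; apply.
  apply/subset_leq_card/subsetP=> y; rewrite !inE => /andP[yY].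
  case/card_gt1P=> u [v []]; rewrite !inE.
  case/andP=> yu /mapP[a sa Eu] /andP[yv /mapP[b sb Ev]] uv.
  rewrite yY; apply/hasP; rewrite -/(e _ _).
  have ab : a != b by apply: contraNneq uv => ab; rewrite Eu Ev ab.
  have [ya yb] : e (x a) y /\ e (x b) y by rewrite -Eu -Ev !(sym_e _ y).
  by case/orP: (mem_pairs sa sb ab) => ?; [exists (a, b) | exists (b, a)];
     rewrite ?/spans ?ya ?yb.
Qed.

(** Soundness is stated in the absence of Berge cycles, so existence follows by classical
    contradiction. *)
Lemma berge_cycle_of_refuted (A : {set T}) es ys : map x (iota 0 k) =i A ->
    models e Y x es ys -> refuted k es ->
  exists u vs ys, berge_cycle e Y A u vs ys.
Proof.
move=> xA m ref; apply: NNPP => no_cycle.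
have no_berge u vs zs : ~ berge_cycle e Y A u vs zs.
  by move=> bc; apply: no_cycle; exists u, vs, zs.
by have := refuted_sound x_inj xA no_berge rules_demand m; rewrite ref.
Qed.
End Labelling.

(** * Extending a Berge cycle by one vertex *)

Lemma berge_cycle_step (A : {set T}) v u vs ys :
    A \subset X -> v \in A -> 3 <= #|A| -> berge_cycle e Y (A :\ v) u vs ys ->
    (forall d, 0 < d < #|A| ->
       refuted #|A| (rcons (cycle_state #|A|) (new_edge #|A| (0, d)))) ->
  exists u vs ys, berge_cycle e Y A u vs ys.
Proof.
move=> sAX vA A3 bc ref; set k := #|A| in A3 ref *.
have szys zs p ws : berge_cycle e Y (A :\ v) p ws zs -> size zs = k.-1.
  case=> Uws wsA _ _ tr; rewrite (size_trail tr) -[_.+1]/(size (p :: ws)).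
  by rewrite -(card_uniqP Uws) (eq_card wsA) /k (cardsD1 v A) vA.
(* The cycle uses [k.-1] hyperedges while (i) provides at least [k]. *)
have /subsetPn[y] : ~~ (super_nbhd e Y A \subset ys).
  apply: contraL (large_super_nbhd sAX A3) => /subset_leq_card sub.
  rewrite -ltnNge -/k; apply: leq_ltn_trans sub _.
  rewrite (leq_ltn_trans (card_size _)) // (szys _ _ _ bc) ltn_predL.
  exact: leq_trans A3.
rewrite inE => /andP[yY y2] ys'y.
(* Of two vertices of [A] in [y], [p] is chosen different from [v], so that the cycle can start
   there. *)
have [p [q [pA yp qA yq pq]]] :
    exists p q, [/\ p \in A :\ v, e p y, q \in A, e q y & p != q].
  case/card_gt1P: y2 => p [q []]; rewrite !inE => /andP[yp pA] /andP[yq qA] pq.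
  have [pv|pv] := eqVneq p v.
    by exists q, p; rewrite !inE !(sym_e _ y) -pv eq_sym pq qA pA yp yq.
  by exists p, q; rewrite !inE !(sym_e _ y) pv pq qA pA yp yq.
have [ws [zs [bcz zsys]]] := berge_cycle_rot bc pA.
have szzs := szys _ _ _ bcz; case: bcz => Uws wsA Uzs zsY tr.
have szws : size ws = k.-2 by rewrite -szzs (size_trail tr).
have k_eq : k = (size ws).+2 by rewrite szws -subn2 -addn2 subnK // ltnW.
(* Labels follow the rotated cycle: [p] gets [0] and [v] gets [k.-1]. *)
pose xs := rcons (p :: ws) v; pose x i := nth p xs i.
have Uxs : uniq xs by rewrite rcons_uniq Uws wsA !inE eqxx.
have szxs : size xs = k by rewrite size_rcons k_eq.
have xsA : xs =i A.
  move=> z; rewrite mem_rcons inE wsA !inE; case: eqVneq => [->|//].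
  by rewrite vA.
have x_xs : map x (iota 0 k) = xs by rewrite -szxs -/(mkseq x _) mkseq_nth.
have x_inj : {in gtn k &, injective x}.
  move=> i j; rewrite !inE -szxs => i_xs j_xs /eqP.
  by rewrite nth_uniq // => /eqP.
have xX i : i < k -> x i \in X.
  by rewrite -szxs => i_xs; rewrite (subsetP sAX) // -xsA mem_nth.
have q_xs : q \in xs by rewrite xsA.
pose d := index q xs.
have d_k : 0 < d < k.
  by rewrite -szxs index_mem q_xs andbT /d /= (negbTE pq).
apply: (berge_cycle_of_refuted A3 x_inj xX (ys := rcons zs y)) (ref d d_k).
  by rewrite x_xs.
apply: models_rcons; rewrite ?zsys //; last by rewrite /spans /= yp /x nth_index.
split=> //; first by rewrite size_map size_iota szzs.
move=> j w b; rewrite /status /cycle_state.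
have [jk|kj] := ltnP j k.-1; last first.
  by rewrite (nth_default [::]) ?size_map ?size_iota ?nth_nil.
rewrite (nth_map 0) ?size_iota // nth_iota // add0n.
have [wk|kw] := ltnP w k; last by rewrite nth_default // size_mkseq.
rewrite nth_mkseq // !inE; case: ifP => // w_j [<-].
have := trail_inc p (x 0) tr (j := j); rewrite szzs => /(_ jk)/andP[xj xj1].
have x1 i : i < k.-1 -> x i = nth p (p :: ws) i.
  by move=> ik; rewrite /x /xs nth_rcons /= k_eq /= in ik *; rewrite ik.
case/orP: w_j => /eqP->; first by rewrite (x1 j).
(* When [j] is [k.-2], the hyperedge closes the cycle and its second vertex is [p], numbered [0]. *)
case: eqP xj1 => [jk2|jk2].
  rewrite nth_rcons (_ : j = size ws) ?ltnn ?eqxx //.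
  by move: jk2; rewrite k_eq => -[].
have jws : j < size ws.
  move: jk; rewrite k_eq /= ltnS leq_eqVlt => /predU1P[Ej|//].
  by case: jk2; rewrite k_eq Ej.
by rewrite nth_rcons jws /= (x1 j.+1) // k_eq.
Qed.

Lemma berge_cycle_exists (A : {set T}) : A \subset X -> 3 <= #|A| <= 6 ->
  exists u vs ys, berge_cycle e Y A u vs ys.
Proof.
move En : #|A| => n; elim: n A En => // n IHn A En sAX /andP[n3 n6].
have A3 : 3 <= #|A| by rewrite En.
(* Here [#|A|] is [n.+1], so this is the base case of triples, refuted from the state without
   hyperedges. *)
have [n2|n2] := eqVneq n 2.
  have szA : size (enum A) = n.+1 by rewrite -cardE.
  have /card_gt0P[x0 _] : 0 < #|A| by rewrite En.
  pose x := nth x0 (enum A).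
  have x_inj : {in gtn n.+1 &, injective x}.
    move=> i j; rewrite !inE -szA => iA jA /eqP.
    by rewrite nth_uniq ?enum_uniq // => /eqP.
  have xX i : i < n.+1 -> x i \in X.
    by rewrite -szA => iA; rewrite (subsetP sAX) // -mem_enum mem_nth.
  apply: (berge_cycle_of_refuted n3 x_inj xX (es := [::]) (ys := [::])).
  - by move=> z; rewrite -szA -/(mkseq x _) mkseq_nth mem_enum.
  - by split=> // j v b; rewrite /status !nth_nil.
  - by rewrite n2; vm_compute.
have [v vA] : exists v, v \in A by apply/card_gt0P; rewrite En.
have n_ge3 : 3 <= n by rewrite ltn_neqAle eq_sym n2 -ltnS.
have [|||u [vs [ys bc]]] := IHn (A :\ v).
- by move: En; rewrite (cardsD1 v) vA => -[].
- exact: subset_trans (subD1set _ _) sAX.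
- by rewrite n_ge3 ltnW.
apply: (berge_cycle_step sAX vA A3 bc) => d; rewrite En => /andP[d0 dn].
have n_in : n.+1 \in [:: 4; 5; 6].
  by case: n {En n2 IHn A3 dn} n_ge3 n6 n3 => [|[|[|[|[|[|]]]]]].
have /allP/(_ _ n_in)/allP/(_ d) := refuted_cycle_states; apply.
by rewrite mem_iota d0 add1n.
Qed.
End Demands.

Theorem theorem1p6 (T : finType) (e : rel T) (X Y : {set T})
  (bigraph_e : bigraph e X Y)
  (large_super_nbhd : forall A : {set T}, A \subset X -> 3 <= #|A| ->
     #|A| <= #|super_nbhd e Y A|)
  (two_connected : forall A : {set T}, A \subset X -> 3 <= #|A| ->
     k_connected 2 e (A :|: super_nbhd e Y A))
  (k : nat) (k_range : k \in [:: 3; 4; 5; 6]) :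
  k_cyclic k e X.
Proof.
move=> A sAX Ak; have A36 : 3 <= #|A| <= 6.
  by rewrite Ak; move: k_range; rewrite !inE => /or4P[] /eqP->.
have [u [vs [ys bc]]] :=
  berge_cycle_exists bigraph_e large_super_nbhd two_connected sAX A36.
by case/andP: A36 => A3 _; apply: berge_graph_cycle bigraph_e sAX A3 bc.
Qed.
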